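(* Let $\mathcal{A}$ be a Boolean algebra. If $\mathcal{A}$ admits an anti-Nikodym sequence of measures which has a strong Nikodym concentration point in $St(\mathcal{A})$, then $\mathcal{A}$ does not have the Grothendieck property (and does not have the Nikodym property).
   Context: For a Boolean algebra $\mathcal{A}$: a measure on $\mathcal{A}$ is a finitely additive $\mu\colon\mathcal{A}\to\mathbb{R}$ with finite variation norm $\|\mu\|=\sup\{|\mu(A)|+|\mu(B)|\colon A,B\in\mathcal{A},A\wedge B=0\}$; for $A\in\mathcal{A}$, $\mu\restriction A$ is the measure $B\mapsto\mu(A\wedge B)$. $St(\mathcal{A})$ is the Stone space, $[A]$ the clopen set of ultrafilters containing $A$, and $\widehat{\mu}$ the unique Radon measure on $St(\mathcal{A})$ with $\widehat\mu([A])=\mu(A)$. A sequence $(\mu_n)$ of measures on $\mathcal{A}$ is anti-Nikodym if $\lim_n\mu_n(A)=0$ for all $A\in\mathcal{A}$ and $\sup_n\|\mu_n\|=\infty$. A point $t\in St(\mathcal{A})$ is a strong Nikodym concentration point of an anti-Nikodym sequence $(\mu_n)$ if for every $N\in\omega$ and every $A\in\mathcal{A}$ with $t\in[A]$ there are a clopen set $U\subseteq[A]\setminus\{t\}$ and $n\in\omega$ with $|\widehat{\mu}_n(U)|>N\cdot(\|\mu_n\restriction A^c\|+1)$. $\mathcal{A}$ has the Nikodym property if it carries no anti-Nikodym sequence; it has the Grothendieck property if every norm bounded sequence of measures converging to $0$ at every element of $\mathcal{A}$ converges weakly to $0$ in the Banach space of measures on $\mathcal{A}$. *)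

(* Defs.v *)
From HB Require Import structures.
From mathcomp Require Import all_boot all_order all_algebra.
From mathcomp Require Import all_classical all_reals all_analysis.

Set Implicit Arguments.
Unset Strict Implicit.
Unset Printing Implicit Defensive.

Import Order.TTheory GRing.Theory Num.Theory.
Import numFieldNormedType.Exports.

Local Open Scope classical_set_scope.
Local Open Scope ring_scope.

(* A Boolean algebra is an [A : ctbDistrLatticeType d]; its operations carry
   the [%O] delimiter to keep them apart from those on sets. *)

Section StoneSpace.
Context {d : Order.disp_t} (A : ctbDistrLatticeType d).

Record stone := Stone {
  stone_set :> set A;
  stone_top : stone_set \top%O;
  stone_bot : ~ stone_set \bot%O;
  stone_meet : forall a b, stone_set a -> stone_set b ->
    stone_set (a `&` b)%O;
  stone_up : forall a b, (a <= b)%O -> stone_set a -> stone_set b;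
  stone_ultra : forall a, stone_set a \/ stone_set (~` a)%O }.

HB.instance Definition _ := gen_eqMixin stone.
HB.instance Definition _ := gen_choiceMixin stone.

Definition stone_clopen (a : A) : set stone := [set t | stone_set t a].

Lemma stone_clopen_cover : \bigcup_(B in range stone_clopen) B = setT.
Proof.
apply/seteqP; split => // t _; exists (stone_clopen \top%O).
  by exists \top%O.
exact: stone_top.
Qed.

Lemma stone_clopen_join (B C : set stone) (t : stone) :
  range stone_clopen B -> range stone_clopen C -> B t -> C t ->
  exists D, [/\ range stone_clopen D, D t & D `<=` B `&` C].
Proof.
move=> [a _ <-] [b _ <-] ta tb; exists (stone_clopen (a `&` b)%O); split.
- by exists (a `&` b)%O.
- exact: stone_meet.
- move=> u uab; split.
    exact: (stone_up (leIl a b) uab).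
  exact: (stone_up (leIr b a) uab).
Qed.

HB.instance Definition _ :=
  @isBaseTopological.Build stone (set stone) (range stone_clopen) id
    stone_clopen_cover stone_clopen_join.

End StoneSpace.

Section Variation.
Context (R : realType) {d : Order.disp_t} (A : ctbDistrLatticeType d).
Implicit Types mu nu : A -> R.

Definition variation_values mu : set R :=
  [set x | exists a b : A,
    (a `&` b)%O = \bot%O /\ x = `|mu a| + `|mu b| ].

Definition variation_norm mu : R := sup (variation_values mu).

Definition finitely_additive mu := forall a b : A,
  (a `&` b)%O = \bot%O -> mu (a `|` b)%O = mu a + mu b.

Definition is_measure mu :=
  finitely_additive mu /\ has_ubound (variation_values mu).

Definition measure_pred : {pred A -> R} := fun mu => `[< is_measure mu >].

Lemma variation_values_nonempty mu : variation_values mu !=set0.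
Proof. by exists (`|mu \bot%O| + `|mu \bot%O|), \bot%O, \bot%O; rewrite meet0x. Qed.

Lemma variation_values_le mu a b : is_measure mu -> (a `&` b)%O = \bot%O ->
  `|mu a| + `|mu b| <= variation_norm mu.
Proof. by move=> [_ bmu] ab; apply: ub_le_sup => //; exists a, b. Qed.

Lemma variation_norm_le mu M :
  (forall a b, (a `&` b)%O = \bot%O -> `|mu a| + `|mu b| <= M) ->
  variation_norm mu <= M.
Proof.
move=> h; apply: ge_sup; first exact: variation_values_nonempty.
by move=> _ [a [b [ab ->]]]; exact: h.
Qed.

Lemma is_measure_intro mu M : finitely_additive mu ->
  (forall a b, (a `&` b)%O = \bot%O -> `|mu a| + `|mu b| <= M) ->
  is_measure mu.
Proof. by move=> amu h; split=> //; exists M => _ [a [b [ab ->]]]; exact: h. Qed.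

Lemma measure_pred_submod_closed : submod_closed measure_pred.
Proof.
split.
  apply/asboolP; apply: (@is_measure_intro _ 0) => [a b _|a b _].
    by rewrite addr0.
  by rewrite normr0 addr0.
move=> r mu nu /asboolP hmu /asboolP hnu; apply/asboolP.
apply: (@is_measure_intro _ (`|r| * variation_norm mu + variation_norm nu)).
  move=> a b ab /=.
  change (r * mu (a `|` b)%O + nu (a `|` b)%O =
          (r * mu a + nu a) + (r * mu b + nu b)).
  by rewrite hmu.1// hnu.1// mulrDr addrACA.
move=> a b ab.
change (`|r * mu a + nu a| + `|r * mu b + nu b| <=
        `|r| * variation_norm mu + variation_norm nu).
apply: (le_trans (lerD (ler_normD _ _) (ler_normD _ _))).
rewrite addrACA !normrM -mulrDr lerD ?variation_values_le//.
by rewrite ler_wpM2l// variation_values_le.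
Qed.

HB.instance Definition _ :=
  GRing.isSubmodClosed.Build R (A -> R) measure_pred measure_pred_submod_closed.

End Variation.

Section MeasureSpace.
Context (R : realType) {d : Order.disp_t} (A : ctbDistrLatticeType d).

Record ba := Ba { ba_fun :> A -> R; ba_funP : ba_fun \in @measure_pred R d A }.

HB.instance Definition _ := [isSub for ba_fun].
HB.instance Definition _ := [Choice of ba by <:].
HB.instance Definition _ := [SubChoice_isSubLmodule of ba by <:].

Lemma ba_is_measure (mu : ba) : is_measure mu.
Proof. by have /asboolP := ba_funP mu. Qed.

Definition ba_norm (mu : ba) : R := variation_norm mu.

Lemma ba_normD (mu nu : ba) : ba_norm (mu + nu) <= ba_norm mu + ba_norm nu.
Proof.
apply: variation_norm_le => a b ab.
change (`|mu a + nu a| + `|mu b + nu b| <= ba_norm mu + ba_norm nu).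
apply: (le_trans (lerD (ler_normD _ _) (ler_normD _ _))).
by rewrite addrACA lerD// variation_values_le//; exact: ba_is_measure.
Qed.

Lemma ba_normZ_le (r : R) (mu : ba) : ba_norm (r *: mu) <= `|r| * ba_norm mu.
Proof.
apply: variation_norm_le => a b ab.
change (`|r * mu a| + `|r * mu b| <= `|r| * ba_norm mu).
by rewrite !normrM -mulrDr ler_wpM2l// variation_values_le//; exact: ba_is_measure.
Qed.

Lemma ba_normZ (r : R) (mu : ba) : ba_norm (r *: mu) = `|r| * ba_norm mu.
Proof.
apply/eqP; rewrite eq_le ba_normZ_le/=.
have [->|r0] := eqVneq r 0.
  rewrite normr0 mul0r.
  apply: (le_trans _ (@variation_values_le _ _ _ _ \bot%O \bot%O _ _)) => //.
  - exact: ba_is_measure.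
  - by rewrite meet0x.
rewrite -ler_pdivlMl ?normr_gt0// -normfV.
by apply: le_trans (ba_normZ_le _ _); rewrite scalerA mulVf// scale1r.
Qed.

Lemma ba_norm0_eq0 (mu : ba) : ba_norm mu = 0 -> mu = 0.
Proof.
move=> mu0; apply/val_inj/funext => a.
have := @variation_values_le _ _ _ _ a \bot%O (ba_is_measure mu) (meetx0 _).
rewrite -/(ba_norm mu) mu0 => h.
apply/eqP; rewrite -normr_le0.
by apply: le_trans h; rewrite lerDl.
Qed.

HB.instance Definition _ :=
  @Lmodule_isNormed.Build R ba ba_norm ba_normD ba_normZ ba_norm0_eq0.

Lemma ba_restr_subproof (mu : ba) (a : A) :
  (fun b => mu (a `&` b)%O) \in @measure_pred R d A.
Proof.
have [amu _] := ba_is_measure mu.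
have disj b c : (b `&` c)%O = \bot%O ->
    ((a `&` b) `&` (a `&` c))%O = \bot%O.
  by move=> bc; rewrite meetACA meetxx bc meetx0.
apply/asboolP; apply: (@is_measure_intro _ _ _ _ (ba_norm mu)).
  by move=> b c bc; rewrite meetUr amu//; exact: disj.
move=> b c bc; apply: variation_values_le; [exact: ba_is_measure|exact: disj].
Qed.

Definition ba_restr (mu : ba) (a : A) : ba := Ba (ba_restr_subproof mu a).

End MeasureSpace.

(* Signed Radon measures.  They are real-valued functions on sets, relevant on
   Borel sets only; the library's charges are not used since they require a
   pointed space, while the Stone space of the degenerate algebra is empty. *)
Section Radon.
Context {R : realType} {T : topologicalType}.
Implicit Types nu : set T -> R.

Definition borel : set (set T) := <<s open >>.

Definition countably_additive nu := forall F : nat -> set T,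
  (forall n, borel (F n)) -> trivIset setT F ->
  series (fun n => nu (F n)) @ \oo --> nu (\bigcup_n F n).

Definition total_variation_on nu (B : set T) : \bar R :=
  ereal_sup [set x | exists C D : set T,
    [/\ borel C, borel D, C `<=` B, D `<=` B & C `&` D = set0] /\
    x = (`|nu C| + `|nu D|)%:E ].

Definition radon nu := countably_additive nu /\
  forall B, borel B -> forall e : R, 0 < e -> exists K : set T,
    [/\ compact K, K `<=` B & (total_variation_on nu (B `\` K) < e%:E)%E].

End Radon.

Section Nikodym.
Context {R : realType} {d : Order.disp_t} {A : ctbDistrLatticeType d}.

(* The Radon measure extending [mu]: it exists and is unique on Borel sets, so
   that neither the choice made by [xget] nor its default value matters. *)
Definition radon_ext (mu : ba R A) : set (stone A) -> R :=
  xget (fun=> 0) [set nu | radon nu /\ forall a, nu (stone_clopen a) = mu a].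

Definition anti_nikodym (mu : nat -> ba R A) :=
  (forall a : A, mu n a @[n --> \oo] --> 0) /\
  ereal_sup (range (fun n => `|mu n|%:E)) = +oo%E.

Definition strong_nikodym_concentration_point
    (mu : nat -> ba R A) (t : stone A) :=
  forall (N : nat) (a : A), stone_clopen a t ->
  exists (U : set (stone A)) (n : nat),
    [/\ clopen U, U `<=` stone_clopen a `\ t &
        N%:R * (`|ba_restr (mu n) (~` a)%O| + 1) < `|radon_ext (mu n) U| ].

End Nikodym.

Definition weakly_cvg {R : realType} {E : normedModType R}
    (u : nat -> E) (l : E) :=
  forall phi : {scalar E}, continuous phi -> phi (u n) @[n --> \oo] --> phi l.

Definition nikodym_property (R : realType) {d : Order.disp_t}
    (A : ctbDistrLatticeType d) :=
  ~ exists mu : nat -> ba R A, anti_nikodym mu.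

Definition grothendieck_property (R : realType) {d : Order.disp_t}
    (A : ctbDistrLatticeType d) :=
  forall mu : nat -> ba R A,
    (exists M : R, forall n, `|mu n| <= M) ->
    (forall a : A, mu n a @[n --> \oo] --> 0) ->
    weakly_cvg mu 0.

(* Main.v *)
From HB Require Import structures.
Require Import Defs.
From mathcomp Require Import all_boot all_order all_algebra.
From mathcomp Require Import all_classical all_reals all_analysis.
From mathcomp Require Import lra.

Set Implicit Arguments.
Unset Strict Implicit.
Unset Printing Implicit Defensive.

Import Order.TTheory GRing.Theory Num.Theory.
Import Order.CTBDistrLatticeTheory.
Import numFieldNormedType.Exports.

Local Open Scope classical_set_scope.
Local Open Scope ring_scope.

(* A strong concentration point [t] of [mu] yields, recursively, neighbourhoods
   [a k] of [t], pairwise disjoint [b k <= a k] not containing [t], and indices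
   [n_ k] such that [m k := mu (n_ k) (b k)] tends to infinity in absolute value
   and dwarfs the variation of [mu (n_ k)] off [a k].  Choosing [b k] almost
   optimally among the clopen subsets of [a k] missing [t], the normalised
   measures [nu k := (m k)^-1 *: mu (n_ k)] are bounded on sets missing [t],
   hence, as their total masses are bounded, on all sets: they are norm bounded
   and tend to [0] pointwise.  Shrinking [a k.+1] so that [nu k] is small on its
   subsets missing [t], the functional [phi nu := \sum_k nu (b k)] satisfies
   [phi (nu k) >= 1 / 2], because [nu k (b k) = 1]; so [nu] is not weakly null. *)

(** * Ultrafilters and clopen sets of the Stone space *)

Section StonePoints.
Context {d : Order.disp_t} {A : ctbDistrLatticeType d}.
Implicit Types (t : stone A) (a b : A).

Lemma stone_join t a b :
  stone_set t (a `|` b)%O -> stone_set t a \/ stone_set t b.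
Proof.
move=> tab; have [ta|ta] := stone_ultra t a; first by left.
have [tb|tb] := stone_ultra t b; first by right.
exfalso; apply: (@stone_bot _ _ t).
have := stone_meet tab (stone_meet ta tb).
by rewrite -complU meetxC.
Qed.

Lemma stone_diff t a b :
  stone_set t a -> ~ stone_set t b -> stone_set t (a `&` ~` b)%O.
Proof. by move=> ta tb; apply: stone_meet => //; case: (stone_ultra t b). Qed.

Lemma stone_compl t a : stone_set t a -> ~ stone_set t (~` a)%O.
Proof.
by move=> ta tca; apply: (@stone_bot _ _ t); rewrite -(meetxC a); exact: stone_meet.
Qed.

Lemma stone_clopenI a b :
  stone_clopen (a `&` b)%O = stone_clopen a `&` stone_clopen b.
Proof.
apply/seteqP; split => t /=; last by case; exact: stone_meet.
by move=> tab; split; [exact: stone_up (leIl _ _) tab|exact: stone_up (leIr _ _) tab].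
Qed.

Lemma stone_open_basis (U : set (stone A)) t : open U -> U t ->
  exists2 a, stone_set t a & stone_clopen a `<=` U.
Proof.
move=> [D' sD <-] [B DB Bt]; have [a _ aB] := sD _ DB.
exists a; first by rewrite -aB in Bt.
by move=> u au; exists B => //; rewrite -aB.
Qed.

(* The usual compactness argument: if no [stone_clopen b] below [U] exhausts
   [U], the sets [U `\` stone_clopen b] generate a filter, and the point of the
   Stone space read off an ultrafilter refining it lies neither in [U] nor
   outside of it. *)
Lemma clopen_stone_clopen (U : set (stone A)) : clopen U ->
  exists b, U = stone_clopen b.
Proof.
move=> [oU cU]; apply: contrapT => nU.
pose I : set A := [set b | stone_clopen b `<=` U].
pose F := filter_from I (fun b => U `\` stone_clopen b).
have FF : ProperFilter F.
  apply: filter_from_proper; last first.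
    move=> b Ib; apply/set0P/eqP => UB; apply: nU; exists b.
    apply/seteqP; split => // t Ut; apply: contrapT => nb.
    by have : set0 t by rewrite -UB.
  apply: filter_from_filter.
    by exists \bot%O => t /= /stone_bot.
  move=> b c Ib Ic; exists (b `|` c)%O.
    by move=> t /= /stone_join [/Ib|/Ic].
  move=> t [Ut nbc]; split; split => // h; apply: nbc => /=.
    exact: stone_up (leUl _ _) h.
  exact: stone_up (leUr _ _) h.
have [G [GU sFG]] := ultraFilterLemma FF.
have GP : ProperFilter G by exact: ultra_proper.
have G0 : ~ G set0 by exact: filter_not_empty.
pose T : set A := [set a | G (stone_clopen a)].
have Ttop : T \top%O.
  by rewrite /T /=; apply: filterS filterT => t _; exact: stone_top.
have Tbot : ~ T \bot%O.
  by rewrite /T /= => h; apply: G0; apply: filterS h => t /stone_bot.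
have Tmeet a b : T a -> T b -> T (a `&` b)%O.
  by rewrite /T /= stone_clopenI; exact: filterI.
have Tup a b : (a <= b)%O -> T a -> T b.
  by move=> ab; apply: filterS => t; exact: stone_up.
have Tultra a : T a \/ T (~` a)%O.
  have [|h] := in_ultra_setVsetC (stone_clopen a) GU; first by left.
  by right; apply: filterS h => t; case: (stone_ultra t a).
pose t := Stone Ttop Tbot Tmeet Tup Tultra.
(* Either case puts two disjoint sets into [G]: [stone_clopen a] and [U] minus it if [t] lies in
   [U], otherwise [U] and a basic clopen set outside [U]. *)
have [Ut|nUt] := pselect (U t).
  have [a Ta aU] := stone_open_basis oU Ut.
  have Ga : G (U `\` stone_clopen a) by apply: sFG; exists a.
  by apply: G0; apply: filterS (filterI Ta Ga) => u [? []].
have [a Ta aU] := stone_open_basis (closed_openC cU) nUt.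
have GUU : G U.
  by apply: sFG; exists \bot%O; [move=> u /= /stone_bot|move=> u []].
by apply: G0; apply: filterS (filterI Ta GUU) => u [/aU].
Qed.

End StonePoints.

(** * Elementary estimates for measures *)

Section Measures.
Context {R : realType} {d : Order.disp_t} {A : ctbDistrLatticeType d}.
Implicit Types (mu nu : ba R A) (t : stone A) (a b c : A).

Lemma ba_additive mu a b : (a `&` b)%O = \bot%O ->
  mu (a `|` b)%O = mu a + mu b.
Proof. exact: (ba_is_measure mu).1. Qed.

Lemma ba_le_norm mu a : `|mu a| <= `|mu|.
Proof.
have := @variation_values_le _ _ _ _ a \bot%O (ba_is_measure mu) (meetx0 _).
by apply: le_trans; rewrite lerDl.
Qed.

Lemma ba_norm_le_sup mu (M : R) : (forall a, `|mu a| <= M) -> `|mu| <= M + M.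
Proof. by move=> h; apply: variation_norm_le => a b _; rewrite lerD. Qed.

Lemma ba_diff mu a b : (b <= a)%O -> mu a = mu b + mu (a `&` ~` b)%O.
Proof.
move=> ba; rewrite -ba_additive; last by rewrite meetCA meetxC meetx0.
by rewrite joinIr joinxC meetx1 join_r.
Qed.

Lemma ba_split mu a b : mu a = mu (a `&` b)%O + mu (a `&` ~` b)%O.
Proof.
rewrite -ba_additive; last by rewrite meetACA meetxC meetx0.
by rewrite -meetUr joinxC meetx1.
Qed.

Lemma ba_restr_norm_le mu a b : (b <= a)%O -> `|mu b| <= `|ba_restr mu a|.
Proof. by move=> ba; have := ba_le_norm (ba_restr mu a) b; rewrite /= meet_r. Qed.

Lemma almost_maximizer (P : set A) (f : A -> R) (M e : R) : P !=set0 ->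
  (forall a, P a -> f a <= M) -> 0 < e ->
  exists2 a, P a & forall b, P b -> f b <= f a + e.
Proof.
move=> [a0 Pa0] fM e0.
have hs : has_sup (f @` P).
  by split; [exists (f a0), a0|exists M => _ [a Pa <-]; exact: fM].
have [_ [a Pa <-] ae] := sup_adherent e0 hs.
exists a => // b Pb; have : f b <= sup (f @` P).
  by apply: ub_le_sup; [exact: hs.2|exists b].
by move=> h; rewrite (le_trans h)// -lerBlDr ltW.
Qed.

(* Remove from [a] two sets missing [t] which almost maximise [mu] and [- mu]. *)
Lemma small_away_from_point mu t a (e : R) : stone_set t a -> 0 < e ->
  exists a', [/\ (a' <= a)%O, stone_set t a' &
    forall c, (c <= a')%O -> ~ stone_set t c -> `|mu c| <= e].
Proof.
move=> ta e0; pose P : set A := [set c | (c <= a)%O /\ ~ stone_set t c].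
have P0 : P !=set0 by exists \bot%O; split; [exact: le0x|exact: stone_bot].
have [b [ba ntb] bmax] := almost_maximizer P0
  (fun c _ => le_trans (ler_norm _) (ba_le_norm mu c)) e0.
have [c [ca ntc] cmax] : exists2 c, P c &
    forall b, P b -> - mu b <= - mu c + e.
  apply: (almost_maximizer (M := `|mu|)) => // c _.
  by rewrite (le_trans (ler_norm _))// normrN ba_le_norm.
exists (a `&` ~` b `&` ~` c)%O; split.
- by rewrite -meetA leIl.
- by apply: stone_diff => //; exact: stone_diff.
move=> x; rewrite !lexI => /andP[/andP[xa xb] xc] ntx.
have join_P y : (y <= a)%O -> ~ stone_set t y -> P (y `|` x)%O.
  by move=> ya nty; split; [rewrite leUx ya|move=> /stone_join[]].
have disj y : (x <= ~` y)%O -> (y `&` x)%O = \bot%O.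
  by rewrite -disj_leC meetC => /eqP.
(* Joining [x] to a near-maximiser stays in [P], so it gains at most [e]: [b] yields [mu x <= e] and
   [c] yields [- mu x <= e]. *)
have := bmax _ (join_P _ ba ntb); have := cmax _ (join_P _ ca ntc).
rewrite !ba_additive ?disj// ler_norml => h1 h2.
by apply/andP; split; lra.
Qed.

(** If [x] meets [a] in a set containing [t], the rest of [a] misses [t], and the value is recovered
    from the total mass. [M2] counts twice: for the part of [x] off [a] and for the complement of
    [a]. The final doubling passes from values to the variation. *)
Lemma ba_norm_le_point nu t a (M1 M2 M3 : R) : stone_set t a ->
  `|nu \top%O| <= M1 -> `|ba_restr nu (~` a)%O| <= M2 ->
  (forall c, (c <= a)%O -> ~ stone_set t c -> `|nu c| <= M3) ->
  `|nu| <= (M1 + M2 + M2 + M3) + (M1 + M2 + M2 + M3).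
Proof.
move=> ta h1 h2 h3; apply: ba_norm_le_sup => x.
have hC y : (y <= ~` a)%O -> `|nu y| <= M2.
  by move=> ya; exact: le_trans (ba_restr_norm_le _ ya) h2.
have hx := hC _ (leIr (~` a)%O x); have ha := hC _ (lexx _).
have h10 : 0 <= M1 by exact: le_trans h1.
have h20 : 0 <= M2 by exact: le_trans ha.
rewrite (ba_split nu x a) (le_trans (ler_normD _ _))//.
have [tx|ntx] := pselect (stone_set t (x `&` a)%O); last first.
  by have := h3 _ (leIr a x) ntx; lra.
have hy : `|nu (a `&` ~` (x `&` a))%O| <= M3.
  apply: h3; first exact: leIl.
  by move=> /(stone_up (leIr _ _)); exact: stone_compl.
have e1 := ba_diff nu (leIr a x).
have e2 : nu \top%O = nu a + nu (~` a)%O.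
  by rewrite (ba_diff nu (lex1 a)) meet1x.
have -> : nu (x `&` a)%O =
    nu \top%O - nu (~` a)%O - nu (a `&` ~` (x `&` a))%O by lra.
have := ler_normB (nu \top%O - nu (~` a)%O) (nu (a `&` ~` (x `&` a))%O).
have := ler_normB (nu \top%O) (nu (~` a)%O).
lra.
Qed.

(** * Limits of measures along nondecreasing sequences *)

Lemma ba_cvg_nondecreasing nu (c : nat -> A) :
  (forall k, (c k <= c k.+1)%O) -> cvgn (fun k => nu (c k)).
Proof.
move=> ndc.
have -> : (fun k => nu (c k)) =
    cst (nu (c 0)) \+ series (telescope (fun k => nu (c k))).
  by apply/funext => k; rewrite [LHS](eq_sum_telescope (fun k => nu (c k))).
apply: is_cvgD; first exact: is_cvg_cst.
(* The increments are absolutely summable, with sums at most twice the norm of [nu]. *)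
apply: normed_cvg; apply: nondecreasing_is_cvgn.
  by apply: nondecreasing_series => n _ _; exact: normr_ge0.
(* Collect in [p] the increments of nonnegative measure and in [q] the others. *)
have hpq n : exists p q, [/\ (p <= c n)%O, (q <= c n)%O &
    \sum_(0 <= k < n) `|telescope (fun k => nu (c k)) k| = nu p - nu q].
  elim: n => [|n [p [q [pc qc e]]]].
    by exists \bot%O, \bot%O; split; rewrite ?le0x// subrr big_geq.
  have dE : telescope (fun k => nu (c k)) n = nu (c n.+1 `&` ~` c n)%O.
    by rewrite /telescope /= (ba_diff nu (ndc n)) addrC addKr.
  have add x : (x <= c n)%O -> (x `|` (c n.+1 `&` ~` c n) <= c n.+1)%O /\
      nu (x `|` (c n.+1 `&` ~` c n))%O = nu x + nu (c n.+1 `&` ~` c n)%O.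
    move=> xc; split; first by rewrite leUx leIl (le_trans xc).
    rewrite ba_additive// meetCA; apply/eqP; rewrite -lex0.
    apply: le_trans (leIr _ _) _.
    by rewrite lex0 disj_leC complK.
  rewrite big_nat_recr//= e dE.
  have [s|s] := lerP 0 (nu (c n.+1 `&` ~` c n)%O).
    exists (p `|` (c n.+1 `&` ~` c n))%O, q; have [h1 h2] := add _ pc.
    by split => //; [exact: le_trans (ndc n)|rewrite h2 ger0_norm//; lra].
  exists p, (q `|` (c n.+1 `&` ~` c n))%O; have [h1 h2] := add _ qc.
  by split => //; [exact: le_trans (ndc n)|rewrite h2 ltr0_norm//; lra].
exists (`|nu| + `|nu|) => _ [n _ <-]; have [p [q [_ _ e]]] := hpq n.
apply: (@le_trans _ _ (nu p - nu q)); first by rewrite -e.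
by rewrite (le_trans (ler_norm _))// (le_trans (ler_normB _ _))// lerD// ba_le_norm.
Qed.

(** Supplies the functional that detects the failure of weak convergence. Each evaluation at [c k]
    is linear and bounded by the norm, and both properties survive the limit. *)
Lemma nondecreasing_lim_functional (c : nat -> A) :
  (forall k, (c k <= c k.+1)%O) ->
  exists2 phi : {scalar ba R A}, continuous phi &
    forall nu, nu (c k) @[k --> \oo] --> phi nu.
Proof.
move=> ndc; pose f nu : R := limn (fun k => nu (c k)).
have fP nu : nu (c k) @[k --> \oo] --> f nu by exact: ba_cvg_nondecreasing.
have lf : linear_for *%R f.
  move=> r nu rho; apply: cvg_lim => //.
  exact: (cvgD (cvgM (cvg_cst r) (fP nu)) (fP rho)).
pose phi : {scalar ba R A} := HB.pack f (GRing.isLinear.Build _ _ _ _ _ lf).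
exists phi => //.
have phi_le nu : `|phi nu| <= `|nu|.
  have h : `|nu (c k)| @[k --> \oo] --> `|phi nu| by exact: cvg_norm (fP nu).
  rewrite -(cvg_lim (@Rhausdorff R) h); apply: limr_le.
    by apply/cvg_ex; eexists; exact: h.
  by apply: nearW => k; exact: ba_le_norm.
apply: (@bounded_linear_continuous _ _ R^o phi).
exists 1; split => // M M1; near=> nu.
apply: (le_trans (phi_le nu)); near: nu.
exact: (@nbhs0_le R (ba R A) M (lt_trans ltr01 M1)).
Unshelve. all: by end_near.
Qed.

(** * Recursive choices at a concentration point *)

Lemma radon_ext_stone_clopen mu (U : set (stone A)) b : radon_ext mu U != 0 ->
  radon_ext mu (stone_clopen b) = mu b.
Proof.
rewrite /radon_ext; set P := [set rho | _].
(* With no extension at hand [xget] would return the zero function, against the nonzero value at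
   [U]. *)
have [exP|nP] := pselect (exists rho, P rho); last first.
  by rewrite (xgetPN _ (fun x Px => nP (ex_intro _ x Px))) eqxx.
by have [_ ->] := xgetPex (fun=> 0) exP.
Qed.

Lemma concentration_step (mu : nat -> ba R A) t (N : nat) a :
  strong_nikodym_concentration_point mu t -> stone_set t a ->
  exists n b a', [/\ (b <= a)%O, ~ stone_set t b,
    N%:R * (`|ba_restr (mu n) (~` a)%O| + 1) < `|mu n b|,
    forall c, (c <= a)%O -> ~ stone_set t c -> `|mu n c| <= 2 * `|mu n b| &
    [/\ (a' <= a `&` ~` b)%O, stone_set t a' &
      forall c, (c <= a')%O -> ~ stone_set t c -> `|mu n c| <= `|mu n b| / 4]].
Proof.
move=> tP ta; have [U [n [/clopen_stone_clopen[b0 UE] Ua muU]]] := tP N a ta.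
pose b := (b0 `&` a)%O.
have UbE : U = stone_clopen b.
  by rewrite stone_clopenI -UE; apply/esym/setIidl => u /Ua[].
have pos : 0 <= N%:R * (`|ba_restr (mu n) (~` a)%O| + 1).
  by rewrite mulr_ge0// addr_ge0.
have U0 : radon_ext (mu n) U != 0.
  by rewrite -normr_gt0; exact: le_lt_trans muU.
rewrite [X in radon_ext _ X]UbE (radon_ext_stone_clopen b U0) in muU.
have ntb : ~ stone_set t b.
  move=> tb; have [_ /(_ erefl)//] : (stone_clopen a `\ t) t.
  by apply: Ua; rewrite UbE.
have mub : 0 < `|mu n b| by exact: le_lt_trans muU.
pose P : set A := [set c | (c <= a)%O /\ ~ stone_set t c].
have Pb : P b by split=> //; exact: leIr.
(* The error allowed is [|mu n b|] itself; passing to the better of [b] and [c] turns it into the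
   factor 2. *)
have [c Pc cmax] : exists2 c, P c &
    forall x, P x -> `|mu n x| <= `|mu n c| + `|mu n b|.
  by apply: (almost_maximizer (M := `|mu n|)) => //; [exists b|move=> x _; exact: ba_le_norm].
have [e [Pe be ce]] : exists e, [/\ P e, `|mu n b| <= `|mu n e| &
    `|mu n c| <= `|mu n e|].
  by have [h|h] := lerP `|mu n b| `|mu n c|; [exists c|exists b; split => //; exact: ltW].
have [a' [aa' ta' small]] : exists a', [/\ (a' <= a `&` ~` e)%O, stone_set t a' &
      forall x, (x <= a')%O -> ~ stone_set t x -> `|mu n x| <= `|mu n e| / 4].
  apply: small_away_from_point; first by apply: stone_diff => //; exact: Pe.2.
  by rewrite divr_gt0// (lt_le_trans mub).
exists n, e, a'; split => //.
- exact: Pe.1.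
- exact: Pe.2.
- exact: lt_le_trans be.
- by move=> x xa ntx; have := cmax x (conj xa ntx); lra.
Qed.

(** The factor [k.+4] serves twice: being at least 4, it makes the normalised measures at most 1/4
    off [a k]; being unbounded, it makes them tend to 0 pointwise. *)
Lemma concentration_sequence (mu : nat -> ba R A) t :
  strong_nikodym_concentration_point mu t ->
  exists (n_ : nat -> nat) (a b : nat -> A), forall k,
  [/\ stone_set t (a k), (b k <= a k)%O, (a k.+1 <= a k `&` ~` b k)%O,
      k.+4%:R * (`|ba_restr (mu (n_ k)) (~` a k)%O| + 1) < `|mu (n_ k) (b k)| &
      (forall c, (c <= a k)%O -> ~ stone_set t c ->
        `|mu (n_ k) c| <= 2 * `|mu (n_ k) (b k)|) /\
      (forall c, (c <= a k.+1)%O -> ~ stone_set t c ->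
        `|mu (n_ k) c| <= `|mu (n_ k) (b k)| / 4)].
Proof.
move=> tP; pose S := {a : A | stone_set t a}.
have step (x : nat * S) : exists y : nat * A * S,
    [/\ (y.1.2 <= sval x.2)%O, (sval y.2 <= sval x.2 `&` ~` y.1.2)%O,
      x.1.+4%:R * (`|ba_restr (mu y.1.1) (~` (sval x.2))%O| + 1)
        < `|mu y.1.1 y.1.2|,
      forall c, (c <= sval x.2)%O -> ~ stone_set t c ->
        `|mu y.1.1 c| <= 2 * `|mu y.1.1 y.1.2| &
      forall c, (c <= sval y.2)%O -> ~ stone_set t c ->
        `|mu y.1.1 c| <= `|mu y.1.1 y.1.2| / 4].
  case: x => k [a ta] /=.
  have [n [b [a' [ba _ h1 h2 [h3 ta' h4]]]]] := concentration_step k.+4 tP ta.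
  by exists ((n, b), exist _ a' ta').
have [g gP] := choice step.
pose s := fix s k : S :=
  if k is k'.+1 then (g (k', s k')).2 else exist _ \top%O (stone_top t).
exists (fun k => (g (k, s k)).1.1), (fun k => sval (s k)), (fun k => (g (k, s k)).1.2).
by move=> k; have [] := gP (k, s k); split => //; exact: svalP.
Qed.

End Measures.

(** * Failure of weak convergence for the normalised measures *)

Lemma cvg_seq_norm_le (R : realType) (u : nat -> R) : cvgn u ->
  exists M : R, forall n, `|u n| <= M.
Proof.
move=> /cvg_seq_bounded [M [_ hM]]; exists (M + 1) => n.
by apply: hM => //; rewrite ltrDl.
Qed.

Section NotGrothendieck.
Context {R : realType} {d : Order.disp_t} {A : ctbDistrLatticeType d}.

Lemma concentration_not_grothendieck (mu : nat -> ba R A) (t : stone A) :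
  anti_nikodym mu -> strong_nikodym_concentration_point mu t ->
  ~ grothendieck_property R A.
Proof.
move=> [mu0 _] /concentration_sequence[n_ [a [b abP]]] gro.
(* The indices [n_ k] may repeat, so pointwise convergence of [nu] comes from this bound divided by
   [|m k|]. *)
have mubd x : exists M : R, forall n, `|mu n x| <= M.
  by apply: cvg_seq_norm_le; apply/cvg_ex; exists 0; exact: mu0.
have ta k : stone_set t (a k) by have [] := abP k.
pose m k : R := mu (n_ k) (b k).
pose nu k : ba R A := (m k)^-1 *: mu (n_ k).
have m_gt k : k.+4%:R * (`|ba_restr (mu (n_ k)) (~` a k)%O| + 1) < `|m k|.
  by have [] := abP k.
have mk k : k.+4%:R < `|m k|.
  apply: le_lt_trans (m_gt k).
  by rewrite ler_peMr// lerDr.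
have m0 k : 0 < `|m k| by apply: lt_trans (mk k); rewrite ltr0n.
have nuE k x : `|nu k x| = `|mu (n_ k) x| / `|m k|.
  by rewrite -normfV mulrC -normrM.
have nub k : nu k (b k) = 1.
  by change ((m k)^-1 * m k = 1); rewrite mulVf// -normr_gt0.
have nu_restr k : `|ba_restr (nu k) (~` a k)%O| <= 1 / 4.
  have -> : ba_restr (nu k) (~` a k)%O = (m k)^-1 *: ba_restr (mu (n_ k)) (~` a k)%O.
    exact/val_inj.
  rewrite normrZ normfV mulrC ler_pdivrMr//.
  have := m_gt k; set r := `|ba_restr _ _|.
  have r0 : 0 <= r by exact: normr_ge0.
  have : 4 * (r + 1) <= k.+4%:R * (r + 1).
    by rewrite ler_wpM2r ?addr_ge0// ler_nat.
  lra.
have nu_le k c : (c <= a k)%O -> ~ stone_set t c -> `|nu k c| <= 2.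
  by move=> ca ntc; rewrite nuE ler_pdivrMr//; have [_ _ _ _ [+ _]] := abP k; apply.
have nu_small k c : (c <= a k.+1)%O -> ~ stone_set t c -> `|nu k c| <= 1 / 4.
  move=> ca ntc; rewrite nuE ler_pdivrMr//; have [_ _ _ _ [_ h]] := abP k.
  by have := h _ ca ntc; rewrite -/(m k); lra.
have nu_cvg x : nu k x @[k --> \oo] --> 0.
  have [M hM] := mubd x.
  apply/norm_cvg0P.
  have h : (fun k : nat => M * k.+1%:R^-1) @ \oo --> (0 : R).
    by rewrite -(mulr0 M); apply: cvgM; [exact: cvg_cst|exact: cvg_harmonic].
  apply: (squeeze_cvgr _ (cvg_cst 0) h).
  apply: nearW => k; rewrite normr_ge0 nuE /=.
  rewrite ler_pM ?invr_ge0// lef_pV2 ?posrE//.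
  by apply: le_trans (ltW (mk k)); rewrite ler_nat ltnS -addn3 leq_addr.
have nu_bd : exists M : R, forall k, `|nu k| <= M.
  have [M hM] := mubd \top%O; have M0 : 0 <= M by exact: le_trans (hM 0%N).
  eexists => k; apply: (ba_norm_le_point (M1 := M) (ta k) _ (nu_restr k) (nu_le k)).
  rewrite nuE ler_pdivrMr// (le_trans (hM _))// ler_peMr//.
  by apply: le_trans (ltW (mk k)); rewrite ler1n.
(* [c k] joins the disjoint [b j] with [j < k], so a measure of [c k] is a partial sum of [phi]. *)
pose c := fix c k := if k is k'.+1 then (c k' `|` b k')%O else (\bot%O : A).
have ndc k : (c k <= c k.+1)%O by exact: leUl.
have ba k : (b k <= a k)%O by have [] := abP k.
have aS k : (a k.+1 <= a k)%O && (a k.+1 <= ~` b k)%O.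
  by rewrite -lexI; have [] := abP k.
have ca k : (c k <= ~` a k)%O.
  elim: k => [|k IH]; first exact: le0x.
  have /andP[h1 h2] := aS k.
  by rewrite /= leUx (lexC (b k)) h2 andbT (le_trans IH)// leC.
have ntc k x : (x <= c k)%O -> ~ stone_set t x.
  by move=> xc tx; apply: (stone_compl (ta k)); apply: stone_up tx; exact: le_trans (ca k).
(* All that is joined from stage [j] on lies below [a j]; with [j = k.+1] this is where [nu k] is
   small. *)
have c_tail j i : (a (i + j)%N <= a j)%O /\ (c (i + j)%N <= c j `|` a j)%O.
  elim: i => [|i [h1 h2]]; first by rewrite leUl.
  have /andP[h3 _] := aS (i + j)%N; split; first exact: le_trans h1.
  by rewrite /= leUx h2 (le_trans (ba _))// (le_trans h1)// leUr.
have [phi phic phiP] := @nondecreasing_lim_functional R _ _ c ndc.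
have /(_ phi phic) := gro nu nu_bd nu_cvg; rewrite linear0 => phi0.
(* For [K > k], [c K] splits into [c k], [b k] and a tail, on which [nu k] is at least -1/4, equal
   to 1, and at least -1/4. *)
have phi_ge k : 1 / 2 <= phi (nu k).
  rewrite -(cvg_lim (@Rhausdorff R) (phiP (nu k))); apply: limr_ge.
    by apply/cvg_ex; eexists; exact: phiP.
  exists k.+1 => // K /= kK.
  have cK : (c k.+1 <= c K)%O.
    rewrite -(subnK kK); elim: (K - k.+1)%N => // i IH.
    exact: le_trans IH (ndc _).
  rewrite [leRHS](ba_diff (nu k) cK).
  have small : `|nu k (c K `&` ~` c k.+1)%O| <= 1 / 4.
    apply: nu_small; last exact: ntc (leIl _ _).
    have [_] := c_tail k.+1 (K - k.+1)%N; rewrite subnK// => h.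
    apply: le_trans (leI2 h (lexx _)) _.
    by rewrite meetUl meetxC join0x leIl.
  have e1 : nu k (c k.+1) = nu k (c k) + 1.
    rewrite -(nub k); apply: ba_additive; apply/eqP; rewrite disj_leC.
    by rewrite (le_trans (ca k))// leC.
  have old : `|nu k (c k)| <= 1 / 4.
    exact: le_trans (ba_restr_norm_le _ (ca k)) (nu_restr k).
  rewrite e1; move: small old; rewrite !ler_norml => /andP[? ?] /andP[? ?].
  lra.
have : 1 / 2 <= (0 : R).
  rewrite -(cvg_lim (@Rhausdorff R) phi0); apply: limr_ge.
    by apply/cvg_ex; eexists; exact: phi0.
  exact: nearW.
lra.
Qed.

End NotGrothendieck.

Theorem theoremF (R : realType) (d : Order.disp_t) (A : ctbDistrLatticeType d) :
  (exists mu : nat -> ba R A, anti_nikodym mu /\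
     exists t : stone A, strong_nikodym_concentration_point mu t) ->
  ~ grothendieck_property R A /\ ~ nikodym_property R A.
Proof.
move=> [mu [muN [t tP]]]; split; last by apply; exists mu.
exact: concentration_not_grothendieck muN tP.
Qed.
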